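(* Let $R_1=\{(t_1,t_2)\in[0,1)^2 : t_1+t_2<1\}$ and $R_2=\{(t_1,t_2)\in[0,1)^2 : t_1+t_2\ge 1\}$. Let $F$ be a smooth function of two real variables which vanishes on the boundary of $R_2$, i.e. \[ F(t,1-t)=F(1,t)=F(t,1)=0\quad\text{for all } t\in[0,1]. \] Define $\Psi_F$ on $[0,1)^2$ (extended with period $1$ in each variable) by $\Psi_F(t_1,t_2)=0$ for $(t_1,t_2)\in R_1$ and $\Psi_F(t_1,t_2)=F(t_1,t_2)$ for $(t_1,t_2)\in R_2$. Then the Fourier series of $\Psi_F$ is absolutely convergent, i.e. \[ \sum_{(r_1,r_2)\in\mathbb{Z}^2}|\hat\Psi_F(r_1,r_2)|<\infty,\qquad \hat\Psi_F(r_1,r_2)=\int_0^1\!\!\int_0^1 \Psi_F(t_1,t_2)e^{-2\pi i(r_1t_1+r_2t_2)}\,dt_1\,dt_2 . \]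
   Context: ''Smooth'' means infinitely differentiable (on a neighborhood of the closed triangle $\{(t_1,t_2)\in[0,1]^2: t_1+t_2\ge 1\}$). *)

(* Defs.v *)
From Stdlib Require Import Reals ZArith List.
From Coquelicot Require Import Coquelicot.
Open Scope R_scope.

Definition closed_triangle (p : R * R) : Prop :=
  0 <= fst p <= 1 /\ 0 <= snd p <= 1 /\ 1 <= fst p + snd p.

(* [ex_diff_n f n x y] only concerns the partial derivatives of order at most
   [n] at the point [(x, y)]; required for all [n] at all points of an open
   set [U], it says that [f] is infinitely differentiable on [U]. *)
Definition smooth_on (U : R * R -> Prop) (f : R -> R -> R) : Prop :=
  forall (n : nat) (x y : R), U (x, y) -> ex_diff_n f n x y.

Definition Csmooth_near_triangle (F : R -> R -> C) : Prop :=
  exists U : R * R -> Prop,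
    open U /\
    (forall p : R * R, closed_triangle p -> U p) /\
    smooth_on U (fun x y => Re (F x y)) /\
    smooth_on U (fun x y => Im (F x y)).

(* The fractional parts give the extension of period 1 in each variable. Both
   lie in [0,1), so the test on their sum separates the region
   t1 + t2 < 1 of [0,1)^2 from the region t1 + t2 >= 1. *)
Definition Psi (F : R -> R -> C) (t1 t2 : R) : C :=
  if Rlt_dec (frac_part t1 + frac_part t2) 1
  then RtoC 0
  else F (frac_part t1) (frac_part t2).

(* exp (i theta) *)
Definition expi (theta : R) : C := (cos theta, sin theta).

(* [C] is taken as a normed module over [R], so [RInt] is the Riemann integral
   of a complex-valued function of a real variable. The inner integral is with
   respect to [t1]. *)
Definition fourier_coef (f : R -> R -> C) (r1 r2 : Z) : C :=
  RInt (V := C_R_CompleteNormedModule)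
    (fun t2 : R =>
       RInt (V := C_R_CompleteNormedModule)
         (fun t1 : R =>
            Cmult (f t1 t2) (expi (- (2 * PI * (IZR r1 * t1 + IZR r2 * t2)))))
         0 1)
    0 1.

(* A family of complex numbers indexed by Z^2 is absolutely summable when the
   sums of moduli over finite sets of indices (duplicate-free lists) are
   bounded. *)
Definition abs_summable (a : Z -> Z -> C) : Prop :=
  exists M : R, forall l : list (Z * Z), NoDup l ->
    fold_right Rplus 0 (map (fun r => Cmod (a (fst r) (snd r))) l) <= M.

(* Main.v *)
Require Import Defs.
From Stdlib Require Import Reals ZArith List FinFun Lra Lia Classical ClassicalEpsilon.
From Coquelicot Require Import Coquelicot.
Open Scope R_scope.

(* Real and imaginary parts reduce the (m, n)-th coefficient to integrals of a
   real f over the triangle against cos (a x + p) cos (b y + q), a = 2 pi m,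
   b = 2 pi n. As f vanishes on the boundary, one integration by parts in x and
   one in y (differentiating under the integral sign, with moving endpoint
   1 - y) give 1 / (a b) times an integral of the same kind, for the mixed
   derivative, plus a one-dimensional integral along the hypotenuse, where the
   frequencies combine to a - b and a + b. One further integration by parts
   bounds the coefficient, with x = 1 + |m|, y = 1 + |n|, by
   C / (x y) * (1 / max (x, y) + 1 / (1 + |m - n|) + 1 / (1 + |m + n|)).
   By AM-GM this is at most a sum of products (1 + |k|)^(-3/2) (1 + |l|)^(-3/2)
   with (k, l) an injective linear image of (m, n), and each of these is
   summable. *)

(** * Summation over Z^2 *)

Definition sum_over {A : Type} (f : A -> R) (l : list A) : R :=
  fold_right Rplus 0 (map f l).

Lemma sum_over_cons {A : Type} (f : A -> R) (x : A) (l : list A) :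
  sum_over f (x :: l) = f x + sum_over f l.
Proof. reflexivity. Qed.

Lemma sum_over_app {A : Type} (f : A -> R) (l1 l2 : list A) :
  sum_over f (l1 ++ l2) = sum_over f l1 + sum_over f l2.
Proof.
  induction l1 as [|x l1 IH]; simpl; [unfold sum_over; simpl; lra|].
  rewrite !sum_over_cons, IH; lra.
Qed.

Lemma sum_over_map {A B : Type} (g : A -> B) (f : B -> R) (l : list A) :
  sum_over f (map g l) = sum_over (fun x => f (g x)) l.
Proof. unfold sum_over; now rewrite map_map. Qed.

Lemma sum_over_scal {A : Type} (c : R) (f : A -> R) (l : list A) :
  sum_over (fun x => c * f x) l = c * sum_over f l.
Proof.
  induction l as [|x l IH]; [unfold sum_over; simpl; lra|].
  rewrite !sum_over_cons, IH; lra.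
Qed.

Lemma sum_over_plus {A : Type} (f g : A -> R) (l : list A) :
  sum_over (fun x => f x + g x) l = sum_over f l + sum_over g l.
Proof.
  induction l as [|x l IH]; [unfold sum_over; simpl; lra|].
  rewrite !sum_over_cons, IH; lra.
Qed.

Lemma sum_over_le {A : Type} (f g : A -> R) (l : list A) :
  (forall x, f x <= g x) -> sum_over f l <= sum_over g l.
Proof.
  intros H; induction l as [|x l IH]; [unfold sum_over; simpl; lra|].
  rewrite !sum_over_cons; specialize (H x); lra.
Qed.

Lemma sum_over_ge_0 {A : Type} (f : A -> R) (l : list A) :
  (forall x, 0 <= f x) -> 0 <= sum_over f l.
Proof.
  intros H; induction l as [|x l IH]; [unfold sum_over; simpl; lra|].
  rewrite sum_over_cons; specialize (H x); lra.
Qed.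

(** Induction on [l]: one occurrence of its head is cut out of [l'], and [NoDup] keeps the tail of
    [l] included in what remains. *)
Lemma sum_over_incl {A : Type} (f : A -> R) (l l' : list A) :
  (forall x, 0 <= f x) -> NoDup l -> incl l l' -> sum_over f l <= sum_over f l'.
Proof.
  intros Hf; revert l'; induction l as [|x l IH]; intros l' Hl Hi.
  - now apply sum_over_ge_0.
  - destruct (in_split x l') as (l1 & l2 & ->); [apply Hi; now left|].
    inversion Hl as [|? ? Hx Hl']; subst.
    assert (H : sum_over f l <= sum_over f (l1 ++ l2)).
    { apply IH; trivial. intros y Hy.
      assert (Hy' := Hi y (or_intror Hy)).
      apply in_app_iff in Hy'; apply in_app_iff.
      destruct Hy' as [?|[<-|?]]; tauto. }
    rewrite sum_over_app in *; rewrite !sum_over_cons; lra.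
Qed.

Lemma sum_over_list_prod {A B : Type} (f : A -> R) (g : B -> R)
    (l1 : list A) (l2 : list B) :
  sum_over (fun p => f (fst p) * g (snd p)) (list_prod l1 l2)
  = sum_over f l1 * sum_over g l2.
Proof.
  induction l1 as [|x l1 IH]; [unfold sum_over; simpl; lra|].
  simpl; rewrite sum_over_app, sum_over_map, sum_over_cons, IH; simpl.
  rewrite sum_over_scal; lra.
Qed.

(** The exponent -1/2 makes all later powers integral: the square is the decay factor 1 / (1 + |n|)
    of one integration by parts, the cube is the summable weight (1 + |n|)^(-3/2). *)
Definition root_weight (n : Z) : R := / sqrt (1 + Rabs (IZR n)).

Lemma root_weight_pos (n : Z) : 0 < root_weight n.
Proof.
  apply Rinv_0_lt_compat, sqrt_lt_R0. pose proof (Rabs_pos (IZR n)); lra.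
Qed.

Lemma root_weight_sqr (n : Z) : root_weight n ^ 2 * (1 + Rabs (IZR n)) = 1.
Proof.
  pose proof (Rabs_pos (IZR n)) as H.
  unfold root_weight; set (s := sqrt (1 + Rabs (IZR n))).
  assert (0 < s) by (apply sqrt_lt_R0; lra).
  rewrite <- (sqrt_sqrt (1 + Rabs (IZR n))) by lra; fold s.
  field; lra.
Qed.

(** With s = sqrt N and t = sqrt (N + 1) this compares (N + 1)^(-3/2) with the integral of x^(-3/2)
    over [N, N + 1]. *)
Lemma root_weight_cube_telescopes (s t : R) :
  0 < s -> 0 < t -> t * t = s * s + 1 -> (/ t) ^ 3 <= 2 * / s - 2 * / t.
Proof.
  intros Hs Ht E.
  assert (Hst : s < t) by nra.
  assert (H : 2 * / s - 2 * / t - (/ t) ^ 3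
              = (2 * t * t * (t - s) - s) / (s * t ^ 3)) by (field; lra).
  assert (0 <= (2 * t * t * (t - s) - s) / (s * t ^ 3)); [|lra].
  assert (0 < t ^ 3) by (apply pow_lt; lra).
  apply Rle_mult_inv_pos; [|nra].
  (* Multiplying the numerator by t + s > 0 removes the difference t - s and leaves 2 t^2 - s (t +
     s), positive since s < t. *)
  assert (E2 : (t - s) * (t + s) = 1) by lra.
  assert ((2 * t * t * (t - s) - s) * (t + s) = 2 * t * t - s * (t + s)).
  { replace ((2 * t * t * (t - s) - s) * (t + s))
      with (2 * t * t * ((t - s) * (t + s)) - s * (t + s)) by ring.
    rewrite E2; ring. }
  nra.
Qed.

Fixpoint symmetric_range (n : nat) : list Z :=
  match n with
  | O => (0 :: nil)%Z
  | S m => (Z.of_nat n :: - Z.of_nat n :: symmetric_range m)%Z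
  end.

Lemma in_symmetric_range (n : nat) (z : Z) :
  (Z.abs z <= Z.of_nat n)%Z -> In z (symmetric_range n).
Proof.
  induction n as [|n IH]; intros H; cbn [symmetric_range In]; [left; lia|].
  destruct (Z.eq_dec z (Z.of_nat (S n))) as [->|H1]; [now left|].
  destruct (Z.eq_dec z (- Z.of_nat (S n))) as [->|H2]; [right; now left|].
  right; right; apply IH; lia.
Qed.

(** Equality holds at n = 0; afterwards each pair of opposite integers contributes two equal cubes,
    paid for by twice the telescoping difference 2 / s - 2 / t. *)
Lemma sum_symmetric_range (n : nat) :
  sum_over (fun z => root_weight z ^ 3) (symmetric_range n)
  <= 5 - 4 * / sqrt (INR (S n)).
Proof.
  induction n as [|n IH].
  - unfold sum_over, root_weight; simpl.
    rewrite Rabs_R0, !Rplus_0_r, sqrt_1, Rinv_1; lra.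
  - cbn [symmetric_range]; rewrite !sum_over_cons.
    unfold root_weight at 1 2.
    rewrite opp_IZR, Rabs_Ropp, <- INR_IZR_INZ, (Rabs_pos_eq (INR (S n)))
      by apply pos_INR.
    assert (Hn : 0 < INR (S n)) by apply lt_0_INR, Nat.lt_0_succ.
    assert (En : INR (S (S n)) = 1 + INR (S n)) by (rewrite (S_INR (S n)); lra).
    rewrite <- En.
    assert (H := root_weight_cube_telescopes (sqrt (INR (S n))) (sqrt (INR (S (S n))))).
    rewrite !sqrt_sqrt in H by lra.
    specialize (H ltac:(apply sqrt_lt_R0; lra) ltac:(apply sqrt_lt_R0; lra) ltac:(lra)).
    lra.
Qed.

Lemma list_Z2_bounded (l : list (Z * Z)) :
  exists n : nat, forall p, In p l ->
    (Z.abs (fst p) <= Z.of_nat n)%Z /\ (Z.abs (snd p) <= Z.of_nat n)%Z.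
Proof.
  induction l as [|q l [n Hn]]; [exists O; intros p []|].
  exists (n + Z.abs_nat (fst q) + Z.abs_nat (snd q))%nat.
  intros p [<-|Hp]; [lia|]. specialize (Hn p Hp); lia.
Qed.

(** A finite set of indices lies in a square, where the sum factors into two sums below 5 each. *)
Lemma sum_weight_prod (l : list (Z * Z)) :
  NoDup l ->
  sum_over (fun p => root_weight (fst p) ^ 3 * root_weight (snd p) ^ 3) l <= 25.
Proof.
  intros Hl. destruct (list_Z2_bounded l) as [n Hn].
  assert (Hw : forall z, 0 <= root_weight z ^ 3)
    by (intros z; apply pow_le, Rlt_le, root_weight_pos).
  eapply Rle_trans.
  { apply (sum_over_incl _ l (list_prod (symmetric_range n) (symmetric_range n)));
      trivial.
    - intros p; apply Rmult_le_pos; apply Hw.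
    - intros [x y] Hp; destruct (Hn _ Hp); apply in_prod;
        now apply in_symmetric_range. }
  rewrite (sum_over_list_prod (fun z => root_weight z ^ 3) (fun z => root_weight z ^ 3)).
  assert (H := sum_symmetric_range n).
  assert (0 < / sqrt (INR (S n))).
  { apply Rinv_0_lt_compat, sqrt_lt_R0, lt_0_INR, Nat.lt_0_succ. }
  assert (0 <= sum_over (fun z => root_weight z ^ 3) (symmetric_range n))
    by now apply sum_over_ge_0.
  nra.
Qed.

Lemma sum_weight_prod_inj (phi : Z * Z -> Z * Z) (l : list (Z * Z)) :
  (forall p q, phi p = phi q -> p = q) -> NoDup l ->
  sum_over (fun p => root_weight (fst (phi p)) ^ 3 * root_weight (snd (phi p)) ^ 3) l
  <= 25.
Proof.
  intros Hphi Hl.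
  rewrite <- (sum_over_map phi
    (fun p => root_weight (fst p) ^ 3 * root_weight (snd p) ^ 3)).
  apply sum_weight_prod, Injective_map_NoDup; trivial.
Qed.

(* The pairs with [m + n] have no counterpart in the complex computation: they
   come from writing a product of two real cosines as a sum. *)
Definition coef_bound (m n : Z) : R :=
  let w z := root_weight z ^ 3 in
  w m * w n + (w m * w (m - n)%Z + w n * w (m - n)%Z)
  + (w m * w (m + n)%Z + w n * w (m + n)%Z).

Lemma sum_coef_bound (l : list (Z * Z)) :
  NoDup l -> sum_over (fun p => coef_bound (fst p) (snd p)) l <= 125.
Proof.
  intros Hl; unfold coef_bound; rewrite !sum_over_plus.
  assert (H := fun phi H => sum_weight_prod_inj phi l H Hl).
  (* One injective linear map for each of the five products in [coef_bound], hence 125 = 5 * 25. *)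
  assert (H1 := H (fun p => (fst p, snd p))).
  assert (H2 := H (fun p => (fst p, fst p - snd p)%Z)).
  assert (H3 := H (fun p => (snd p, fst p - snd p)%Z)).
  assert (H4 := H (fun p => (fst p, fst p + snd p)%Z)).
  assert (H5 := H (fun p => (snd p, fst p + snd p)%Z)).
  simpl in H1, H2, H3, H4, H5.
  assert (L : forall a b c d e : R,
    a <= 25 -> b <= 25 -> c <= 25 -> d <= 25 -> e <= 25 ->
    a + (b + c) + (d + e) <= 125) by (intros; lra).
  apply L;
    [apply H1|apply H2|apply H3|apply H4|apply H5];
    intros [x y] [x' y'] E; injection E; intros; f_equal; simpl in *; lia.
Qed.

Lemma abs_summable_of_coef_bound (c : Z -> Z -> C) (K : R) :
  (forall m n, Cmod (c m n) <= K * coef_bound m n) -> abs_summable c.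
Proof.
  (* The absolute value is taken because the sign of [K] is unknown. *)
  intros H; exists (Rabs K * 125); intros l Hl.
  change (sum_over (fun p => Cmod (c (fst p) (snd p))) l <= Rabs K * 125).
  eapply Rle_trans; [apply sum_over_le; intros p; apply H|].
  rewrite sum_over_scal.
  assert (0 <= sum_over (fun p => coef_bound (fst p) (snd p)) l).
  { apply sum_over_ge_0; intros p; unfold coef_bound.
    assert (Hw : forall z, 0 <= root_weight z ^ 3)
      by (intros z; apply pow_le, Rlt_le, root_weight_pos).
    repeat apply Rplus_le_le_0_compat; apply Rmult_le_pos; apply Hw. }
  eapply Rle_trans; [apply Rmult_le_compat_r; [trivial|apply Rle_abs]|].
  apply Rmult_le_compat_l; [apply Rabs_pos|]. now apply sum_coef_bound.
Qed.

(** AM-GM from the factorization a^3 + b^3 + c^3 - 3abc = (a + b + c) ((a - b)^2 + (b - c)^2 + (a -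
    c)^2) / 2. *)
Lemma cubes_ge_prod (a b c : R) :
  0 <= a -> 0 <= b -> 0 <= c -> 3 * (a * b * c) <= a ^ 3 + b ^ 3 + c ^ 3.
Proof.
  intros Ha Hb Hc.
  pose proof (pow2_ge_0 (a - b)); pose proof (pow2_ge_0 (b - c));
    pose proof (pow2_ge_0 (a - c)).
  assert (0 <= (a + b + c) * ((a - b) ^ 2 + (b - c) ^ 2 + (a - c) ^ 2))
    by (apply Rmult_le_pos; lra).
  nra.
Qed.

(* With [u, v, s = (1 + |k|)^(-1/2)] for [k = m, n, m - n], the product
   [1 / ((1 + |m|) (1 + |n|) (1 + |m - n|))] is [(u v) (u s) (v s)], and AM-GM
   bounds it by the cubes. *)
Lemma weight_le_coef_bound (m n : Z) (J G E K : R) :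
  0 <= K -> 0 <= G ->
  (1 + Rabs (IZR m)) * (1 + Rabs (IZR n)) * J <= G + E ->
  (1 + Rabs (IZR m)) * G <= K ->
  (1 + Rabs (IZR n)) * G <= K ->
  E <= K * (root_weight (m - n) ^ 2 + root_weight (m + n) ^ 2) ->
  J <= 2 * K * coef_bound m n.
Proof.
  intros HK HG HJ H1 H2 HE.
  unfold coef_bound.
  generalize (root_weight_sqr m) (root_weight_sqr n) (Rabs_pos (IZR m)) (Rabs_pos (IZR n)).
  generalize (root_weight_pos m) (root_weight_pos n)
    (root_weight_pos (m - n)) (root_weight_pos (m + n)).
  revert HJ H1 H2 HE.
  generalize (root_weight m) (root_weight n) (root_weight (m - n)) (root_weight (m + n))
    (Rabs (IZR m)) (Rabs (IZR n)).
  intros u v s t x y HJ H1 H2 HE Hu Hv Hs Ht Eu Ev Hx Hy.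
  assert (HG1 : G <= K * u ^ 2).
  { replace G with (u ^ 2 * ((1 + x) * G)); [|rewrite <- Rmult_assoc, Eu; ring].
    rewrite (Rmult_comm K). apply Rmult_le_compat_l; nra. }
  assert (HG2 : G <= K * v ^ 2).
  { replace G with (v ^ 2 * ((1 + y) * G)); [|rewrite <- Rmult_assoc, Ev; ring].
    rewrite (Rmult_comm K). apply Rmult_le_compat_l; nra. }
  (* The minimum of u^2 and v^2 is at most their geometric mean u v. *)
  assert (HG3 : G <= K * (u * v)).
  { destruct (Rle_dec u v); [eapply Rle_trans; [apply HG1|]|eapply Rle_trans; [apply HG2|]];
      apply Rmult_le_compat_l; nra. }
  assert (HJ' : J <= (u ^ 2 * v ^ 2) * (K * (u * v) + K * (s ^ 2 + t ^ 2))).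
  { replace J with ((u ^ 2 * v ^ 2) * ((1 + x) * (1 + y) * J)).
    - apply Rmult_le_compat_l; [nra|lra].
    - transitivity ((u ^ 2 * (1 + x)) * (v ^ 2 * (1 + y)) * J); [ring|].
      rewrite Eu, Ev; ring. }
  assert (A1 := cubes_ge_prod (u * v) (u * s) (v * s)
    ltac:(nra) ltac:(nra) ltac:(nra)).
  assert (A2 := cubes_ge_prod (u * v) (u * t) (v * t)
    ltac:(nra) ltac:(nra) ltac:(nra)).
  rewrite !Rpow_mult_distr in A1, A2.
  assert (P : forall a b, 0 < a -> 0 < b -> 0 < a ^ 3 * b ^ 3).
  { intros; apply Rmult_lt_0_compat; now apply pow_lt. }
  assert (P1 := P u v Hu Hv). assert (P2 := P u s Hu Hs). assert (P3 := P v s Hv Hs).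
  assert (P4 := P u t Hu Ht). assert (P5 := P v t Hv Ht).
  eapply Rle_trans; [apply HJ'|].
  replace (u ^ 2 * v ^ 2 * (K * (u * v) + K * (s ^ 2 + t ^ 2)))
    with (K * (u ^ 3 * v ^ 3 + u * v * (u * s) * (v * s) + u * v * (u * t) * (v * t)))
    by ring.
  (* The term u^3 v^3 occurs once directly and with weight 1/3 from each AM-GM, in total 5/3, which
     the factor 2 absorbs. *)
  rewrite (Rmult_comm 2 K), (Rmult_assoc K 2). apply Rmult_le_compat_l; [trivial|]. lra.
Qed.
(** * Smooth functions near the triangle *)

(** An open neighborhood of the triangle of explicit shape, leaving room [e] beyond the endpoints of
    every slice and thus for derivatives at boundary points. *)
Definition collar (e : R) (p : R * R) : Prop :=
  - e < fst p < 1 + e /\ - e < snd p < 1 + e /\ 1 - e < fst p + snd p.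

Lemma off_triangle_locally (x y : R) :
  ~ closed_triangle (x, y) ->
  locally_2d (fun u v => ~ closed_triangle (u, v)) x y.
Proof.
  unfold closed_triangle; simpl; intros H.
  assert (H' : x < 0 \/ 1 < x \/ y < 0 \/ 1 < y \/ x + y < 1) by lra.
  assert (K : forall d : R, 0 < d ->
    (forall u v, Rabs (u - x) < d -> Rabs (v - y) < d ->
      ~ (0 <= u <= 1 /\ 0 <= v <= 1 /\ 1 <= u + v)) ->
    locally_2d (fun u v => ~ (0 <= u <= 1 /\ 0 <= v <= 1 /\ 1 <= u + v)) x y).
  { intros d Hd Hd'; now exists (mkposreal d Hd). }
  destruct H' as [L|[L|[L|[L|L]]]];
    [apply (K (- x))|apply (K (x - 1))|apply (K (- y))|apply (K (y - 1))
    |apply (K ((1 - x - y) / 2))]; try lra;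
    intros u v Hu%Rabs_def2 Hv%Rabs_def2; lra.
Qed.

(* [M] plays the role of an upper bound, or of the inverse of a radius. *)
Lemma triangle_compact (Q : R -> R -> R -> Prop) :
  (forall x y M M', M <= M' -> Q x y M -> Q x y M') ->
  (forall x y, closed_triangle (x, y) ->
     exists M, locally_2d (fun u v => closed_triangle (u, v) -> Q u v M) x y) ->
  exists M, 0 < M /\ forall x y, closed_triangle (x, y) -> Q x y M.
Proof.
  intros Qmono Qloc.
  (* The compactness theorem covers the whole square, so points off the triangle also get a radius,
     on which the claim is vacuous. *)
  assert (D : forall x y, exists d : posreal, forall u v,
    Rabs (u - x) < d -> Rabs (v - y) < d -> closed_triangle (u, v) -> Q u v (/ d)).
  { intros x y.
    destruct (classic (closed_triangle (x, y))) as [T|T].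
    - destruct (Qloc x y T) as [M [d Hd]].
      (* Shrinking the radius below 1 / M lets its inverse serve as the bound, so a uniform radius
         is also a uniform bound. *)
      assert (Hm : 0 < Rmin d (/ Rmax M 1)).
      { apply Rmin_glb_lt; [apply cond_pos|].
        apply Rinv_0_lt_compat; pose proof (Rmax_r M 1); lra. }
      exists (mkposreal _ Hm); simpl; intros u v Hu Hv Tuv.
      apply (Qmono u v M).
      + apply Rle_trans with (Rmax M 1); [apply Rmax_l|].
        rewrite <- (Rinv_inv (Rmax M 1)) at 1.
        apply Rinv_le_contravar; [trivial|apply Rmin_r].
      + apply Hd; trivial; eapply Rlt_le_trans; eauto; apply Rmin_l.
    - destruct (off_triangle_locally x y T) as [d Hd].
      exists d; intros u v Hu Hv Tuv; now destruct (Hd u v Hu Hv). }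
  set (delta x y := proj1_sig (constructive_indefinite_description _ (D x y))).
  assert (Hdelta : forall x y u v, Rabs (u - x) < delta x y -> Rabs (v - y) < delta x y ->
    closed_triangle (u, v) -> Q u v (/ delta x y)).
  { intros x y; unfold delta.
    now destruct (constructive_indefinite_description _ (D x y)). }
  destruct (compactness_value_2d 0 1 0 1 delta) as [d Hd].
  exists (/ d); split; [apply Rinv_0_lt_compat, cond_pos|].
  (* [compactness_value_2d] provides the center of a covering box only under a double negation. *)
  intros x y T; apply NNPP; intros HN.
  apply (Hd x y); [apply T|apply T|].
  intros (u & v & _ & _ & Hu & Hv & Hle); apply HN.
  apply (Qmono x y (/ delta u v)); [|now apply Hdelta].
  apply Rinv_le_contravar; [apply cond_pos|trivial].
Qed.

(** A Lebesgue number argument: by compactness, boxes of one common radius 1 / M around all points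
    of the triangle lie in [U]. *)
Lemma collar_in_open (U : R * R -> Prop) :
  open U -> (forall p, closed_triangle p -> U p) ->
  exists e, 0 < e /\ forall p, collar e p -> U p.
Proof.
  intros HU HT.
  destruct (triangle_compact
    (fun x y M => 0 < M /\
       forall u v, Rabs (u - x) < / M -> Rabs (v - y) < / M -> U (u, v)))
    as [M [HM H]].
  - intros x y M M' HMM' [HM H]; split; [lra|].
    assert (/ M' <= / M) by (apply Rinv_le_contravar; lra).
    intros u v Hu Hv; apply H; lra.
  - intros x y T.
    assert (L : locally_2d (fun u v => U (u, v)) x y).
    { apply locally_2d_locally.
      apply filter_imp with U; [now intros [a b]|]. apply HU, HT, T. }
    destruct L as [d Hd].
    (* Its inverse is d / 2: points within d / 2 of the center keep a box of radius d / 2 inside the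
       box of radius [d]. *)
    exists (2 / d).
    assert (Hd2 : 0 < d / 2) by (pose proof (cond_pos d); lra).
    exists (mkposreal _ Hd2); simpl; intros u v Hu Hv _.
    assert (E : / (2 / d) = d / 2) by (field; pose proof (cond_pos d); lra).
    split; [apply Rdiv_lt_0_compat; [lra|apply cond_pos]|].
    rewrite E; intros u' v' Hu' Hv'.
    apply Rabs_def2 in Hu, Hv, Hu', Hv'.
    apply Hd; apply Rabs_def1; lra.
  - assert (HM' : 0 < / M) by now apply Rinv_0_lt_compat.
    exists (Rmin 1 (/ M) / 2).
    assert (H0 : 0 < Rmin 1 (/ M)) by (apply Rmin_glb_lt; lra).
    pose proof (Rmin_l 1 (/ M)); pose proof (Rmin_r 1 (/ M)).
    set (e := Rmin 1 (/ M) / 2) in *.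
    assert (He : 0 < e <= 1 / 2 /\ e < / M) by (unfold e; lra).
    split; [lra|].
    intros [x y] (Hx & Hy & Hxy); simpl in *.
    (* Moving both coordinates up by [e], truncated at 1, reaches the triangle from any point of the
       collar; each coordinate changes by at most e < 1 / M. *)
    destruct (H (Rmin 1 (x + e)) (Rmin 1 (y + e))) as [_ H'].
    { unfold closed_triangle; simpl.
      unfold Rmin; destruct Rle_dec; destruct Rle_dec; lra. }
    apply H'; unfold Rmin; destruct Rle_dec; apply Rabs_def1; lra.
Qed.

Lemma continuity_2d_bounded (f : R -> R -> R) :
  (forall x y, closed_triangle (x, y) -> continuity_2d_pt f x y) ->
  exists M, 0 < M /\ forall x y, closed_triangle (x, y) -> Rabs (f x y) <= M.
Proof.
  intros Hf; apply (triangle_compact (fun x y M => Rabs (f x y) <= M)).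
  - intros; lra.
  - intros x y T; exists (Rabs (f x y) + 1).
    destruct (Hf x y T (mkposreal 1 Rlt_0_1)) as [d Hd]; exists d.
    intros u v Hu Hv _; specialize (Hd u v Hu Hv); simpl in Hd.
    pose proof (Rabs_triang_inv (f u v) (f x y)); lra.
Qed.

Lemma collar_locally (e x y : R) :
  collar e (x, y) -> locally_2d (fun u v => collar e (u, v)) x y.
Proof.
  intros (Hx & Hy & Hxy); simpl in *.
  set (d := Rmin (Rmin (x + e) (1 + e - x))
              (Rmin (Rmin (y + e) (1 + e - y)) ((x + y - 1 + e) / 2))).
  assert (Hd : 0 < d) by (repeat apply Rmin_glb_lt; lra).
  exists (mkposreal d Hd); simpl; intros u v Hu%Rabs_def2 Hv%Rabs_def2.
  assert (d <= x + e /\ d <= 1 + e - x /\ d <= y + e /\ d <= 1 + e - y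
          /\ d <= (x + y - 1 + e) / 2).
  { unfold d; repeat split; unfold Rmin; repeat destruct Rle_dec; lra. }
  unfold collar; simpl; lra.
Qed.

Lemma triangle_collar (e x y : R) :
  0 < e -> closed_triangle (x, y) -> collar e (x, y).
Proof. unfold collar, closed_triangle; simpl; lra. Qed.

(** * Partial derivatives and differentiation under the integral sign *)

Definition D1 (f : R -> R -> R) (x y : R) : R := Derive (fun z => f z y) x.
Definition D2 (f : R -> R -> R) (x y : R) : R := Derive (fun z => f x z) y.

Lemma smooth_D1 (U : R * R -> Prop) (f : R -> R -> R) :
  smooth_on U f -> smooth_on U (D1 f).
Proof. intros Hf n x y H; exact (ex_diff_n_deriv_aux1 f n x y (Hf (S n) x y H)). Qed.

Lemma smooth_D2 (U : R * R -> Prop) (f : R -> R -> R) :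
  smooth_on U f -> smooth_on U (D2 f).
Proof. intros Hf n x y H; exact (ex_diff_n_deriv_aux2 f n x y (Hf (S n) x y H)). Qed.

Lemma smooth_continuity (U : R * R -> Prop) (f : R -> R -> R) (x y : R) :
  smooth_on U f -> U (x, y) -> continuity_2d_pt f x y.
Proof. intros Hf H; now destruct (Hf O x y H). Qed.

Lemma smooth_is_derive_1 (U : R * R -> Prop) (f : R -> R -> R) (x y : R) :
  smooth_on U f -> U (x, y) -> is_derive (fun z => f z y) x (D1 f x y).
Proof.
  intros Hf H; apply (Derive_correct (fun z => f z y)).
  now destruct (Hf 1%nat x y H) as (_ & ? & _).
Qed.

Lemma smooth_is_derive_2 (U : R * R -> Prop) (f : R -> R -> R) (x y : R) :
  smooth_on U f -> U (x, y) -> is_derive (fun z => f x z) y (D2 f x y).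
Proof.
  intros Hf H; apply (Derive_correct (fun z => f x z)).
  now destruct (Hf 1%nat x y H) as (_ & _ & ? & _).
Qed.

Lemma continuous_comp_2d (f : R -> R -> R) (g h : R -> R) (t : R) :
  continuous g t -> continuous h t -> continuity_2d_pt f (g t) (h t) ->
  continuous (fun s => f (g s) (h s)) t.
Proof.
  intros Hg Hh Hf.
  apply (continuous_comp_2 g h f t); trivial.
  now apply (continuity_2d_pt_filterlim f).
Qed.

(** The chain rule along z -> (1 - z, z); total differentiability comes from [D1 f] existing nearby
    and being continuous, together with [D2 f] at the point. *)
Lemma smooth_is_derive_hypotenuse (e : R) (f : R -> R -> R) (y : R) :
  0 < e -> smooth_on (collar e) f -> 0 <= y <= 1 ->
  is_derive (fun z => f (1 - z) z) y (D2 f (1 - y) y - D1 f (1 - y) y).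
Proof.
  intros He Hf Hy.
  assert (T : collar e (1 - y, y)).
  { apply triangle_collar; trivial; unfold closed_triangle; simpl; lra. }
  apply is_derive_Reals.
  replace (D2 f (1 - y) y - D1 f (1 - y) y)
    with (D1 f (1 - y) y * (-1) + D2 f (1 - y) y * 1) by ring.
  apply (derivable_pt_lim_comp_2d f (fun z => 1 - z) (fun z => z)).
  - apply filterdiff_differentiable_pt_lim.
    apply (is_derive_filterdiff f (1 - y) y (D1 f) (D2 f (1 - y) y)).
    + generalize (proj1 (locally_2d_locally _ _ _) (collar_locally _ _ _ T)).
      apply filter_imp; intros [u v]; simpl. now apply smooth_is_derive_1.
    + now apply (smooth_is_derive_2 (collar e)).
    + apply (continuity_2d_pt_filterlim (D1 f)).
      apply (smooth_continuity (collar e)); trivial. now apply smooth_D1.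
  - apply is_derive_Reals. auto_derive; trivial; ring.
  - apply is_derive_Reals. auto_derive; trivial.
Qed.

(** The Leibniz rule: the lower endpoint 1 - z moves with speed -1, which adds the value of [g] on
    the hypotenuse. *)
Lemma is_derive_RInt_slice (e : R) (g : R -> R -> R) (y : R) :
  0 < e -> 0 <= y <= 1 ->
  (forall u v, collar e (u, v) -> continuity_2d_pt g u v) ->
  (forall u v, collar e (u, v) -> ex_derive (fun z => g u z) v) ->
  (forall u v, collar e (u, v) -> continuity_2d_pt (D2 g) u v) ->
  is_derive (fun z => RInt (fun x => g x z) (1 - z) 1) y
    (RInt (fun x => D2 g x y) (1 - y) 1 + g (1 - y) y).
Proof.
  intros He Hy Hc Hd Hc2.
  assert (He4 : 0 < e / 4) by lra.
  set (d := mkposreal _ He4).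
  (* With margins e / 4 in both variables, u + v stays above 1 - e / 2. *)
  assert (Hcol : forall u v, 1 - y - e / 4 <= u <= 1 + e / 4 -> Rabs (v - y) < e / 4 ->
    collar e (u, v)).
  { intros u v Hu Hv%Rabs_def2; unfold collar; simpl; lra. }
  (* The parametric integral lemma takes the parameter as first argument, whereas here it is the
     second argument of [g]. *)
  assert (Hswap : forall (h : R -> R -> R) u v, continuity_2d_pt h u v ->
    continuity_2d_pt (fun a b => h b a) v u).
  { intros h u v Hh eps; destruct (Hh eps) as [r Hr]; exists r; auto. }
  assert (Hint : forall a b v, Rabs (v - y) < e / 4 ->
    1 - y - e / 4 <= a <= b -> b <= 1 + e / 4 -> ex_RInt (fun x => g x v) a b).
  { intros a b v Hv Ha Hb; apply (ex_RInt_continuous (V := R_CompleteNormedModule)).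
    rewrite Rmin_left, Rmax_right by lra; intros z Hz.
    apply (continuous_comp_2d g (fun x => x) (fun _ => v));
      [apply continuous_id|apply continuous_const|].
    apply Hc, Hcol; lra. }
  replace (RInt (fun x => D2 g x y) (1 - y) 1 + g (1 - y) y)
    with (RInt (fun x => Derive (fun z => g x z) y) (1 - y) 1
          + - g (1 - y) y * (-1)) by (unfold D2; ring).
  apply (is_derive_RInt_param_bound_comp_aux2 (fun v u => g u v) (fun z => 1 - z) 1 y (-1)).
  - exists d; intros v Hv; apply Hint; [exact Hv|lra|lra].
  - exists d, d; intros v Hv; apply Hint; [exact Hv|simpl; lra|simpl; lra].
  - auto_derive; trivial; ring.
  - exists d, d; intros v Hv t Ht; simpl in Ht; apply Hd, Hcol; [|exact Hv].
    assert (Rmax (1 - y + e / 4) 1 <= 1 + e / 4) by (apply Rmax_lub; lra).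
    rewrite Rmin_left in Ht by lra; lra.
  - intros t Ht; rewrite Rmin_left, Rmax_right in Ht by lra.
    apply (Hswap (D2 g)), Hc2, Hcol; [lra|].
    rewrite Rminus_diag, Rabs_R0; lra.
  - exists d; intros v u Hv Hu; simpl in Hv, Hu; apply Rabs_def2 in Hu.
    apply (Hswap (D2 g)), Hc2, Hcol; [lra|exact Hv].
  - apply continuity_pt_filterlim.
    apply (continuous_comp_2d g (fun x => x) (fun _ => y));
      [apply continuous_id|apply continuous_const|].
    apply Hc, Hcol; [lra|]. rewrite Rminus_diag, Rabs_R0; lra.
Qed.

(** * Oscillatory integrals *)

Lemma is_derive_cos_lin (a p x : R) :
  is_derive (fun t => cos (a * t + (p - PI / 2))) x (a * cos (a * x + p)).
Proof.
  auto_derive; trivial.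
  replace (a * x + (p - PI / 2)) with (- (PI / 2 - (a * x + p))) by ring.
  rewrite sin_neg, sin_shift; ring.
Qed.

Lemma continuous_cos_lin (a p x : R) : continuous (fun t => cos (a * t + p)) x.
Proof.
  apply (ex_derive_continuous (K := R_AbsRing) (V := R_NormedModule)).
  auto_derive; trivial.
Qed.

Lemma continuous_mult_cos (h : R -> R) (a p x : R) :
  continuous h x -> continuous (fun t => h t * cos (a * t + p)) x.
Proof.
  intros H; apply (continuous_mult (K := R_AbsRing) h (fun t => cos (a * t + p))); trivial.
  apply continuous_cos_lin.
Qed.

Lemma ex_RInt_mult_cos (h : R -> R) (a p u v : R) :
  u <= v -> (forall x, u <= x <= v -> continuous h x) ->
  ex_RInt (fun x => h x * cos (a * x + p)) u v.
Proof.
  intros Huv H; apply (ex_RInt_continuous (V := R_CompleteNormedModule)).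
  rewrite Rmin_left, Rmax_right by trivial; intros x Hx.
  now apply continuous_mult_cos, H.
Qed.

Lemma Rabs_mult_cos_le (x t : R) : Rabs (x * cos t) <= Rabs x.
Proof.
  rewrite Rabs_mult; rewrite <- (Rmult_1_r (Rabs x)) at 2.
  apply Rmult_le_compat_l; [apply Rabs_pos|].
  apply Rabs_le, COS_bound.
Qed.

Lemma Rabs_RInt_mult_cos_le (h : R -> R) (a p u v M : R) :
  u <= v -> (forall x, u <= x <= v -> continuous h x) ->
  (forall x, u <= x <= v -> Rabs (h x) <= M) ->
  Rabs (RInt (fun x => h x * cos (a * x + p)) u v) <= (v - u) * M.
Proof.
  intros Huv Hc HM; apply abs_RInt_le_const; trivial.
  - now apply ex_RInt_mult_cos.
  - intros t Ht; eapply Rle_trans; [apply Rabs_mult_cos_le|auto].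
Qed.

(* Integration by parts turns [cos (a x + p)] into
   [sin (a x + p) = cos (a x + (p - PI / 2))]; written without division by [a],
   it is also valid for [a = 0]. *)
Lemma RInt_cos_by_parts (h dh : R -> R) (a p u v : R) :
  u <= v ->
  (forall x, u <= x <= v -> is_derive h x (dh x)) ->
  (forall x, u <= x <= v -> continuous dh x) ->
  a * RInt (fun x => h x * cos (a * x + p)) u v
  = h v * cos (a * v + (p - PI / 2)) - h u * cos (a * u + (p - PI / 2))
    - RInt (fun x => dh x * cos (a * x + (p - PI / 2))) u v.
Proof.
  intros Huv Hd Hc.
  assert (Hh : forall x, u <= x <= v -> continuous h x).
  { intros x Hx; apply (ex_derive_continuous (K := R_AbsRing) (V := R_NormedModule)).
    eexists; now apply Hd. }
  assert (I1 := ex_RInt_mult_cos h a p u v Huv Hh).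
  assert (I2 := ex_RInt_mult_cos dh a (p - PI / 2) u v Huv Hc).
  assert (I := is_RInt_derive (V := R_CompleteNormedModule)
    (fun x => h x * cos (a * x + (p - PI / 2)))
    (fun x => dh x * cos (a * x + (p - PI / 2)) + a * (h x * cos (a * x + p))) u v).
  rewrite Rmin_left, Rmax_right in I by trivial.
  apply (is_RInt_unique (V := R_CompleteNormedModule)) in I.
  - assert (S := RInt_scal (V := R_CompleteNormedModule) _ u v a I1).
    assert (P := RInt_plus (V := R_CompleteNormedModule) _ _ u v I2
                   (ex_RInt_scal (V := R_CompleteNormedModule) _ u v a I1)).
    change (RInt (fun x => a * (h x * cos (a * x + p))) u v
            = a * RInt (fun x => h x * cos (a * x + p)) u v) in S.
    change (RInt (fun x => dh x * cos (a * x + (p - PI / 2))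
                           + a * (h x * cos (a * x + p))) u v
            = RInt (fun x => dh x * cos (a * x + (p - PI / 2))) u v
              + RInt (fun x => a * (h x * cos (a * x + p))) u v) in P.
    change (RInt (fun x => dh x * cos (a * x + (p - PI / 2))
                           + a * (h x * cos (a * x + p))) u v
            = h v * cos (a * v + (p - PI / 2)) - h u * cos (a * u + (p - PI / 2))) in I.
    lra.
  - intros x Hx.
    replace (dh x * cos (a * x + (p - PI / 2)) + a * (h x * cos (a * x + p)))
      with (dh x * cos (a * x + (p - PI / 2)) + h x * (a * cos (a * x + p))) by ring.
    apply (is_derive_mult (K := R_AbsRing) h (fun t => cos (a * t + (p - PI / 2))));
      [now apply Hd|apply is_derive_cos_lin|].
    intros; apply Rmult_comm.
  - intros x Hx; apply (continuous_plus (V := R_NormedModule)).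
    + now apply continuous_mult_cos, Hc.
    + apply (continuous_mult (K := R_AbsRing) (fun _ => a)); [apply continuous_const|].
      now apply continuous_mult_cos, Hh.
Qed.

(** The 1 in 1 + |a| costs [M] by the trivial bound; |a| costs 3 [M] by parts, two boundary terms
    and one integral over a length at most 1. *)
Lemma RInt_cos_decay (h dh : R -> R) (a p u v M : R) :
  u <= v <= u + 1 ->
  (forall x, u <= x <= v -> is_derive h x (dh x)) ->
  (forall x, u <= x <= v -> continuous dh x) ->
  (forall x, u <= x <= v -> Rabs (h x) <= M) ->
  (forall x, u <= x <= v -> Rabs (dh x) <= M) ->
  (1 + Rabs a) * Rabs (RInt (fun x => h x * cos (a * x + p)) u v) <= 4 * M.
Proof.
  intros Huv Hd Hc HM HM'.
  assert (Hh : forall x, u <= x <= v -> continuous h x).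
  { intros x Hx; apply (ex_derive_continuous (K := R_AbsRing) (V := R_NormedModule)).
    eexists; now apply Hd. }
  assert (B1 := Rabs_RInt_mult_cos_le h a p u v M ltac:(lra) Hh HM).
  assert (B2 := Rabs_RInt_mult_cos_le dh a (p - PI / 2) u v M ltac:(lra) Hc HM').
  assert (E := RInt_cos_by_parts h dh a p u v ltac:(lra) Hd Hc).
  rewrite Rmult_plus_distr_r, <- Rabs_mult, E.
  assert (0 <= M) by (eapply Rle_trans; [apply Rabs_pos|apply (HM u); lra]).
  assert ((v - u) * M <= M) by nra.
  assert (C1 := Rle_trans _ _ _ (Rabs_mult_cos_le (h v) (a * v + (p - PI / 2)))
                  (HM v ltac:(lra))).
  assert (C2 := Rle_trans _ _ _ (Rabs_mult_cos_le (h u) (a * u + (p - PI / 2)))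
                  (HM u ltac:(lra))).
  revert B1 B2 C1 C2.
  generalize (RInt (fun x => h x * cos (a * x + p)) u v)
    (RInt (fun x => dh x * cos (a * x + (p - PI / 2))) u v)
    (h v * cos (a * v + (p - PI / 2))) (h u * cos (a * u + (p - PI / 2))).
  intros r1 r2 r3 r4; unfold Rabs; repeat destruct Rcase_abs; lra.
Qed.

(* Phases [- PI / 2] turn the cosines below into sines. *)
Definition inner (f : R -> R -> R) (a p y : R) : R :=
  RInt (fun x => f x y * cos (a * x + p)) (1 - y) 1.

Definition osc (f : R -> R -> R) (a b p q : R) : R :=
  RInt (fun y => inner f a p y * cos (b * y + q)) 0 1.

(** The contribution of the moving endpoint 1 - y when [inner] is differentiated in [y]. *)
Definition edge (f : R -> R -> R) (a b p q : R) : R :=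
  RInt (fun y => f (1 - y) y * cos (a * (1 - y) + p) * cos (b * y + q)) 0 1.

Lemma smooth_bounded (e : R) (f : R -> R -> R) :
  0 < e -> smooth_on (collar e) f ->
  exists M, 0 < M /\ forall x y, closed_triangle (x, y) -> Rabs (f x y) <= M.
Proof.
  intros He Hf; apply continuity_2d_bounded; intros x y T.
  apply (smooth_continuity (collar e)); trivial. now apply triangle_collar.
Qed.

Lemma slice_triangle (x y : R) :
  0 <= y <= 1 -> 1 - y <= x <= 1 -> closed_triangle (x, y).
Proof. unfold closed_triangle; simpl; lra. Qed.

Lemma smooth_continuous_slice (e : R) (f : R -> R -> R) (x y : R) :
  0 < e -> smooth_on (collar e) f -> closed_triangle (x, y) ->
  continuous (fun t => f t y) x.
Proof.
  intros He Hf T.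
  apply (continuous_comp_2d f (fun t => t) (fun _ => y));
    [apply continuous_id|apply continuous_const|].
  apply (smooth_continuity (collar e)); trivial. now apply triangle_collar.
Qed.

Lemma smooth_continuous_hypotenuse (e : R) (f : R -> R -> R) (y : R) :
  0 < e -> smooth_on (collar e) f -> 0 <= y <= 1 ->
  continuous (fun t => f (1 - t) t) y.
Proof.
  intros He Hf Hy.
  apply (ex_derive_continuous (K := R_AbsRing) (V := R_NormedModule)).
  eexists; now apply (smooth_is_derive_hypotenuse e).
Qed.

(** * Integration by parts on the triangle and the resulting decay *)

Lemma inner_by_parts (e : R) (f : R -> R -> R) (a p y : R) :
  0 < e -> smooth_on (collar e) f -> 0 <= y <= 1 ->
  a * inner f a p y
  = f 1 y * cos (a * 1 + (p - PI / 2))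
    - f (1 - y) y * cos (a * (1 - y) + (p - PI / 2))
    - inner (D1 f) a (p - PI / 2) y.
Proof.
  intros He Hf Hy.
  apply (RInt_cos_by_parts (fun x => f x y) (fun x => D1 f x y)); [lra| |];
    intros x Hx; assert (T := slice_triangle x y Hy Hx).
  - apply (smooth_is_derive_1 (collar e)); trivial. now apply triangle_collar.
  - apply (smooth_continuous_slice e); trivial. now apply smooth_D1.
Qed.

Lemma inner_decay (e : R) (f : R -> R -> R) :
  0 < e -> smooth_on (collar e) f ->
  exists K, 0 < K /\ forall a p y, 0 <= y <= 1 ->
    (1 + Rabs a) * Rabs (inner f a p y) <= K.
Proof.
  intros He Hf.
  destruct (smooth_bounded e f He Hf) as (M & HM & HMf).
  destruct (smooth_bounded e (D1 f) He (smooth_D1 _ _ Hf)) as (M' & HM' & HMf').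
  exists (4 * (M + M')); split; [lra|]; intros a p y Hy.
  apply (RInt_cos_decay (fun x => f x y) (fun x => D1 f x y)); [lra| | | |];
    intros x Hx; assert (T := slice_triangle x y Hy Hx).
  - apply (smooth_is_derive_1 (collar e)); trivial. now apply triangle_collar.
  - apply (smooth_continuous_slice e); trivial. now apply smooth_D1.
  - specialize (HMf x y T); lra.
  - specialize (HMf' x y T); lra.
Qed.

Lemma is_derive_inner (e : R) (f : R -> R -> R) (a p y : R) :
  0 < e -> smooth_on (collar e) f -> 0 <= y <= 1 ->
  is_derive (inner f a p) y
    (inner (D2 f) a p y + f (1 - y) y * cos (a * (1 - y) + p)).
Proof.
  intros He Hf Hy.
  set (g x z := f x z * cos (a * x + p)).
  assert (Dg : forall x z, D2 g x z = D2 f x z * cos (a * x + p))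
    by (intros x z; apply Derive_scal_l).
  assert (Hcos : forall x z, continuity_2d_pt (fun u _ : R => cos (a * u + p)) x z).
  { intros x z; apply (continuity_1d_2d_pt_comp (fun u => cos (a * u + p)) (fun u _ => u)).
    - apply continuity_pt_filterlim, continuous_cos_lin.
    - apply continuity_2d_pt_id1. }
  replace (inner (D2 f) a p y) with (RInt (fun x => D2 g x y) (1 - y) 1).
  - apply (is_derive_RInt_slice e g y); trivial; intros u v Huv.
    + apply continuity_2d_pt_mult; trivial.
      now apply (smooth_continuity (collar e)).
    + exists (D2 f u v * cos (a * u + p)).
      apply (is_derive_scal_l (K := R_AbsRing) (V := R_NormedModule) (fun z => f u z)).
      now apply (smooth_is_derive_2 (collar e)).
    + apply continuity_2d_pt_ext with (fun x z => D2 f x z * cos (a * x + p)); [easy|].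
      apply continuity_2d_pt_mult; trivial.
      apply (smooth_continuity (collar e)); trivial. now apply smooth_D2.
  - apply (RInt_ext (V := R_CompleteNormedModule)); intros x _; apply Dg.
Qed.

Lemma continuous_inner (e : R) (f : R -> R -> R) (a p y : R) :
  0 < e -> smooth_on (collar e) f -> 0 <= y <= 1 -> continuous (inner f a p) y.
Proof.
  intros He Hf Hy; apply (ex_derive_continuous (K := R_AbsRing) (V := R_NormedModule)).
  eexists; now apply (is_derive_inner e).
Qed.

Lemma continuous_edge (e : R) (f : R -> R -> R) (a p y : R) :
  0 < e -> smooth_on (collar e) f -> 0 <= y <= 1 ->
  continuous (fun t => f (1 - t) t * cos (a * (1 - t) + p)) y.
Proof.
  intros He Hf Hy; apply (continuous_mult (K := R_AbsRing) (fun t => f (1 - t) t)).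
  - now apply (smooth_continuous_hypotenuse e).
  - apply (ex_derive_continuous (K := R_AbsRing) (V := R_NormedModule)).
    auto_derive; trivial.
Qed.

(** The terms at y = 1 and along the hypotenuse are kept, since this is applied both to [F], where
    they vanish, and to [D1 F], where the edge term survives. *)
Lemma osc_by_parts_outer (e : R) (f : R -> R -> R) (a b p q : R) :
  0 < e -> smooth_on (collar e) f ->
  b * osc f a b p q
  = inner f a p 1 * cos (b * 1 + (q - PI / 2))
    - osc (D2 f) a b p (q - PI / 2) - edge f a b p (q - PI / 2).
Proof.
  intros He Hf.
  assert (Hf2 := smooth_D2 _ _ Hf).
  unfold osc at 1.
  rewrite (RInt_cos_by_parts (inner f a p)
    (fun y => inner (D2 f) a p y + f (1 - y) y * cos (a * (1 - y) + p))); [|lra| |].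
  (* At y = 0 the slice of the triangle is a single point. *)
  - assert (E0 : inner f a p 0 = 0).
    { unfold inner; rewrite Rminus_0_r; apply (RInt_point (V := R_CompleteNormedModule)). }
    rewrite E0.
    assert (ES : RInt (fun y => (inner (D2 f) a p y + f (1 - y) y * cos (a * (1 - y) + p))
                                * cos (b * y + (q - PI / 2))) 0 1
      = osc (D2 f) a b p (q - PI / 2) + edge f a b p (q - PI / 2)); [|lra].
    unfold osc, edge.
    rewrite <- (RInt_plus (V := R_CompleteNormedModule)).
    + apply (RInt_ext (V := R_CompleteNormedModule)); intros y _.
      unfold plus; simpl; ring.
    + apply ex_RInt_mult_cos; [lra|]. intros y Hy; now apply (continuous_inner e).
    + apply (ex_RInt_mult_cos (fun y => f (1 - y) y * cos (a * (1 - y) + p))); [lra|].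
      intros y Hy; now apply (continuous_edge e).
  - intros y Hy; now apply (is_derive_inner e).
  - intros y Hy; apply (continuous_plus (V := R_NormedModule)).
    + now apply (continuous_inner e).
    + now apply (continuous_edge e).
Qed.

Lemma osc_by_parts_inner (e : R) (f : R -> R -> R) (a b p q : R) :
  0 < e -> smooth_on (collar e) f ->
  (forall t, 0 <= t <= 1 -> f t (1 - t) = 0 /\ f 1 t = 0) ->
  a * osc f a b p q = - osc (D1 f) a b (p - PI / 2) q.
Proof.
  intros He Hf H0; unfold osc.
  rewrite <- (RInt_scal (V := R_CompleteNormedModule)),
    <- (RInt_opp (V := R_CompleteNormedModule)).
  - apply (RInt_ext (V := R_CompleteNormedModule)).
    rewrite Rmin_left, Rmax_right by lra; intros y Hy.
    change (a * (inner f a p y * cos (b * y + q))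
            = - (inner (D1 f) a (p - PI / 2) y * cos (b * y + q))).
    rewrite <- Rmult_assoc, (inner_by_parts e) by (trivial; lra).
    destruct (H0 y) as [_ ->]; [lra|].
    (* The endpoint (1 - y, y) of the slice is the hypotenuse point with parameter t = 1 - y. *)
    destruct (H0 (1 - y)) as [E _]; [lra|].
    replace (1 - (1 - y)) with y in E by ring. rewrite E; ring.
  - apply ex_RInt_mult_cos; [lra|]. intros y Hy; apply (continuous_inner e); trivial.
    now apply smooth_D1.
  - apply ex_RInt_mult_cos; [lra|]. intros y Hy; now apply (continuous_inner e).
Qed.

(** The product of two cosines is half the sum of cosines with frequencies b - a and -(a + b) in
    [y]; one-dimensional decay applies to each. *)
Lemma edge_decay (e : R) (f : R -> R -> R) :
  0 < e -> smooth_on (collar e) f ->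
  exists K, 0 < K /\ forall a b p q,
    Rabs (edge f a b p q) <= K * (/ (1 + Rabs (a - b)) + / (1 + Rabs (a + b))).
Proof.
  intros He Hf.
  assert (Hf1 := smooth_D1 _ _ Hf). assert (Hf2 := smooth_D2 _ _ Hf).
  destruct (smooth_bounded e f He Hf) as (M & HM & B).
  destruct (smooth_bounded e (D1 f) He Hf1) as (M1 & HM1 & B1).
  destruct (smooth_bounded e (D2 f) He Hf2) as (M2 & HM2 & B2).
  assert (T : forall y, 0 <= y <= 1 -> closed_triangle (1 - y, y))
    by (intros y Hy; unfold closed_triangle; simpl; lra).
  set (K := 4 * (M + M1 + M2)); exists K; split; [unfold K; lra|].
  assert (HD : forall c r,
    Rabs (RInt (fun y => f (1 - y) y * cos (c * y + r)) 0 1) <= K * / (1 + Rabs c)).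
  { intros c r. pose proof (Rabs_pos c).
    apply (Rmult_le_reg_l (1 + Rabs c)); [lra|].
    replace ((1 + Rabs c) * (K * / (1 + Rabs c))) with K by (field; lra).
    apply (RInt_cos_decay (fun y => f (1 - y) y)
             (fun y => D2 f (1 - y) y - D1 f (1 - y) y)); [lra| | | |]; intros y Hy.
    - now apply (smooth_is_derive_hypotenuse e).
    - apply (continuous_minus (V := R_NormedModule));
        now apply (smooth_continuous_hypotenuse e).
    - specialize (B _ _ (T y Hy)); lra.
    - specialize (B1 _ _ (T y Hy)); specialize (B2 _ _ (T y Hy)).
      apply Rabs_le; apply Rabs_le_between in B1, B2; lra. }
  intros a b p q.
  assert (ES : edge f a b p q
    = / 2 * (RInt (fun y => f (1 - y) y * cos ((b - a) * y + (a + p + q))) 0 1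
           + RInt (fun y => f (1 - y) y * cos (- (a + b) * y + (a + p - q))) 0 1)).
  { unfold edge.
    assert (I : forall c r, ex_RInt (fun y => f (1 - y) y * cos (c * y + r)) 0 1).
    { intros c r; apply (ex_RInt_mult_cos (fun y => f (1 - y) y)); [lra|].
      intros y Hy; now apply (smooth_continuous_hypotenuse e). }
    rewrite <- (RInt_plus (V := R_CompleteNormedModule)) by apply I.
    rewrite <- (RInt_scal (V := R_CompleteNormedModule)).
    - apply (RInt_ext (V := R_CompleteNormedModule)); intros y _.
      unfold scal, plus; simpl; unfold mult; simpl.
      replace ((b - a) * y + (a + p + q))
        with ((a * (1 - y) + p) + (b * y + q)) by ring.
      replace (- (a + b) * y + (a + p - q))
        with ((a * (1 - y) + p) - (b * y + q)) by ring.
      generalize (a * (1 - y) + p) (b * y + q); intros s t.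
      rewrite cos_plus, cos_minus; field.
    - apply (ex_RInt_plus (V := R_CompleteNormedModule)); apply I. }
  rewrite ES.
  assert (H1 := HD (b - a) (a + p + q)). assert (H2 := HD (- (a + b)) (a + p - q)).
  rewrite Rabs_minus_sym in H1; rewrite Rabs_Ropp in H2.
  rewrite Rabs_mult, Rabs_pos_eq by lra.
  eapply Rle_trans; [apply Rmult_le_compat_l; [lra|apply Rabs_triang]|].
  pose proof (Rabs_pos (RInt (fun y => f (1 - y) y * cos ((b - a) * y + (a + p + q))) 0 1)).
  pose proof (Rabs_pos (RInt (fun y => f (1 - y) y * cos (- (a + b) * y + (a + p - q))) 0 1)).
  lra.
Qed.

(** Decay in [a] is inherited from [inner], uniformly in [y]; decay in [b] comes from
    [osc_by_parts_outer], all of whose terms are bounded. It serves for [F] and for its derivatives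
    alike, whatever their boundary values. *)
Lemma osc_decay_first_order (e : R) (f : R -> R -> R) :
  0 < e -> smooth_on (collar e) f ->
  exists K, 0 < K /\ forall a b p q,
    (1 + Rabs a) * Rabs (osc f a b p q) <= K /\
    (1 + Rabs b) * Rabs (osc f a b p q) <= K.
Proof.
  intros He Hf.
  assert (B : forall g, smooth_on (collar e) g ->
    exists K, 0 < K /\ forall a b p q, (1 + Rabs a) * Rabs (osc g a b p q) <= K).
  { intros g Hg. destruct (inner_decay e g He Hg) as (K & HK & B).
    exists K; split; trivial; intros a b p q.
    assert (0 <= Rabs a) by apply Rabs_pos.
    assert (E : Rabs (osc g a b p q) <= (1 - 0) * (K / (1 + Rabs a))).
    { apply Rabs_RInt_mult_cos_le; [lra| |].
      - intros y Hy; now apply (continuous_inner e).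
      - intros y Hy; apply (Rmult_le_reg_l (1 + Rabs a)); [lra|].
        replace ((1 + Rabs a) * (K / (1 + Rabs a))) with K by (field; lra).
        now apply B. }
    replace K with ((1 + Rabs a) * ((1 - 0) * (K / (1 + Rabs a)))) at 1 by (field; lra).
    apply Rmult_le_compat_l; lra. }
  destruct (B f Hf) as (K & HK & BK).
  destruct (B (D2 f) (smooth_D2 _ _ Hf)) as (K2 & HK2 & BK2).
  destruct (inner_decay e f He Hf) as (Ki & HKi & BKi).
  destruct (edge_decay e f He Hf) as (Ke & HKe & BKe).
  (* [K] bounds the integral itself; [Ki], [K2] and 2 [Ke] bound the three terms of the integration
     by parts, the edge term being at most [Ke] (1 + 1). *)
  exists (K + K2 + Ki + 2 * Ke); split; [lra|]; intros a b p q.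
  assert (H1 := BK a b p q). assert (H2 := BK2 a b p (q - PI / 2)).
  assert (H3 := BKi a p 1 ltac:(lra)). assert (H4 := BKe a b p (q - PI / 2)).
  split; [lra|].
  rewrite Rmult_plus_distr_r, <- Rabs_mult, (osc_by_parts_outer e) by trivial.
  assert (N : forall x y, (1 + Rabs x) * Rabs y = Rabs y + Rabs x * Rabs y)
    by (intros; ring).
  assert (NP : forall x y, 0 <= Rabs x * Rabs y)
    by (intros; apply Rmult_le_pos; apply Rabs_pos).
  rewrite N in H1, H2, H3.
  assert (P1 := NP a (osc f a b p q)). assert (P2 := NP a (osc (D2 f) a b p (q - PI / 2))).
  assert (P3 := NP a (inner f a p 1)).
  assert (I : forall x, / (1 + Rabs x) <= 1).
  { intros x; rewrite <- Rinv_1 at 2; apply Rinv_le_contravar; [lra|].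
    pose proof (Rabs_pos x); lra. }
  assert (I1 := I (a - b)). assert (I2 := I (a + b)).
  assert (H4' : Rabs (edge f a b p (q - PI / 2)) <= 2 * Ke).
  { eapply Rle_trans; [apply H4|]; nra. }
  assert (H5 := Rabs_mult_cos_le (inner f a p 1) (b * 1 + (q - PI / 2))).
  assert (T := Rabs_triang
    (inner f a p 1 * cos (b * 1 + (q - PI / 2)) - osc (D2 f) a b p (q - PI / 2))
    (- edge f a b p (q - PI / 2))).
  assert (T' := Rabs_triang (inner f a p 1 * cos (b * 1 + (q - PI / 2)))
    (- osc (D2 f) a b p (q - PI / 2))).
  rewrite Rabs_Ropp in T, T'.
  unfold Rminus in *. lra.
Qed.

Lemma Rabs_IZR_le_2PI (m : Z) : Rabs (IZR m) <= Rabs (2 * PI * IZR m).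
Proof.
  rewrite Rabs_mult, (Rabs_pos_eq (2 * PI)) by (pose proof PI_RGT_0; lra).
  pose proof (Rabs_pos (IZR m)); pose proof PI2_1; nra.
Qed.

Lemma Rinv_2PI_le_root_weight (m : Z) :
  / (1 + Rabs (2 * PI * IZR m)) <= root_weight m ^ 2.
Proof.
  pose proof (Rabs_IZR_le_2PI m); pose proof (Rabs_pos (IZR m)).
  pose proof (root_weight_sqr m).
  replace (root_weight m ^ 2) with (/ (1 + Rabs (IZR m))).
  - apply Rinv_le_contravar; lra.
  - symmetry; apply (Rmult_eq_reg_r (1 + Rabs (IZR m))); [|lra].
    rewrite Rinv_l; lra.
Qed.

(* Integrating by parts once in each variable gives
   [a b osc F = osc (D2 (D1 F)) + edge (D1 F)] up to phase shifts: the first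
   term gains one more factor [1 / max (|a|, |b|)], the edge term a factor
   [1 / |a - b| + 1 / |a + b|]. *)
Lemma osc_decay (e : R) (F : R -> R -> R) :
  0 < e -> smooth_on (collar e) F ->
  (forall t, 0 <= t <= 1 -> F t (1 - t) = 0 /\ F 1 t = 0 /\ F t 1 = 0) ->
  exists K, forall m n p q,
    Rabs (osc F (2 * PI * IZR m) (2 * PI * IZR n) p q) <= K * coef_bound m n.
Proof.
  intros He HF H0.
  assert (HF1 := smooth_D1 _ _ HF). assert (HF2 := smooth_D2 _ _ HF).
  assert (HF12 := smooth_D2 _ _ HF1).
  destruct (osc_decay_first_order e F He HF) as (K0 & HK0 & B0).
  destruct (osc_decay_first_order e (D1 F) He HF1) as (K1 & HK1 & B1).
  destruct (osc_decay_first_order e (D2 F) He HF2) as (K2 & HK2 & B2).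
  destruct (osc_decay_first_order e (D2 (D1 F)) He HF12) as (K3 & HK3 & B3).
  destruct (edge_decay e (D1 F) He HF1) as (K4 & HK4 & B4).
  set (K := K0 + K1 + K2 + K3 + K4).
  exists (2 * K); intros m n p q.
  set (a := 2 * PI * IZR m); set (b := 2 * PI * IZR n).
  assert (Ea : Rabs (a * osc F a b p q) = Rabs (osc (D1 F) a b (p - PI / 2) q)).
  { rewrite (osc_by_parts_inner e), Rabs_Ropp; trivial.
    intros t Ht; destruct (H0 t Ht) as (? & ? & _); now split. }
  assert (Z1 : forall f r, (forall x, 0 < x < 1 -> f x 1 = 0) -> inner f a r 1 = 0).
  { intros f r Hf; unfold inner; rewrite Rminus_diag.
    rewrite (RInt_ext (V := R_CompleteNormedModule) _ (fun _ => 0)).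
    - rewrite (RInt_const (V := R_CompleteNormedModule)).
      unfold scal; simpl; unfold mult; simpl; ring.
    - rewrite Rmin_left, Rmax_right by lra; intros x Hx; rewrite Hf by trivial.
      apply Rmult_0_l. }
  assert (ZF : inner F a p 1 = 0).
  { apply Z1; intros x Hx; destruct (H0 x) as (_ & _ & ->); lra. }
  (* On the edge y = 1, [D1 F] is the tangential derivative of a function that vanishes there. *)
  assert (ZF1 : inner (D1 F) a (p - PI / 2) 1 = 0).
  { apply Z1; intros x Hx; unfold D1.
    rewrite (Derive_ext_loc _ (fun _ => 0)); [apply Derive_const|].
    apply (locally_interval _ x 0 1); [simpl; lra|simpl; lra|].
    intros y Hy0 Hy1; simpl in *; destruct (H0 y) as (_ & _ & ->); lra. }
  assert (Zedge : edge F a b p (q - PI / 2) = 0).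
  { unfold edge; rewrite (RInt_ext (V := R_CompleteNormedModule) _ (fun _ => 0)).
    - rewrite (RInt_const (V := R_CompleteNormedModule)).
      unfold scal; simpl; unfold mult; simpl; ring.
    - rewrite Rmin_left, Rmax_right by lra; intros y Hy.
      destruct (H0 (1 - y)) as (E & _); [lra|].
      replace (1 - (1 - y)) with y in E by ring. rewrite E, !Rmult_0_l.
      reflexivity. }
  assert (Eb : Rabs (b * osc F a b p q) = Rabs (osc (D2 F) a b p (q - PI / 2))).
  { rewrite (osc_by_parts_outer e), ZF, Zedge by trivial.
    rewrite <- Rabs_Ropp; f_equal; ring. }
  (* After the integration by parts in [x], the one in [y] acts on [D1 F], whose hypotenuse integral
     is the only surviving boundary term. *)
  assert (Eab : Rabs (b * (a * osc F a b p q))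
    <= Rabs (osc (D2 (D1 F)) a b (p - PI / 2) (q - PI / 2))
       + Rabs (edge (D1 F) a b (p - PI / 2) (q - PI / 2))).
  { rewrite Rabs_mult, Ea, <- Rabs_mult, (osc_by_parts_outer e), ZF1 by trivial.
    eapply Rle_trans; [|apply Rabs_triang].
    rewrite <- Rabs_Ropp; apply Req_le; f_equal; ring. }
  specialize (B0 a b p q). specialize (B1 a b (p - PI / 2) q).
  specialize (B2 a b p (q - PI / 2)). specialize (B3 a b (p - PI / 2) (q - PI / 2)).
  specialize (B4 a b (p - PI / 2) (q - PI / 2)).
  rewrite !Rabs_mult in Eab; rewrite Rabs_mult in Ea, Eb.
  assert (Hm : Rabs (IZR m) <= Rabs a) by apply Rabs_IZR_le_2PI.
  assert (Hn : Rabs (IZR n) <= Rabs b) by apply Rabs_IZR_le_2PI.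
  assert (W1 := Rinv_2PI_le_root_weight (m - n)).
  assert (W2 := Rinv_2PI_le_root_weight (m + n)).
  rewrite minus_IZR in W1; rewrite plus_IZR in W2.
  replace (2 * PI * (IZR m - IZR n)) with (a - b) in W1 by (unfold a, b; ring).
  replace (2 * PI * (IZR m + IZR n)) with (a + b) in W2 by (unfold a, b; ring).
  pose proof (Rabs_pos (osc F a b p q)) as P0.
  pose proof (Rabs_pos (osc (D1 F) a b (p - PI / 2) q)) as P1.
  pose proof (Rabs_pos (osc (D2 F) a b p (q - PI / 2))) as P2.
  pose proof (Rabs_pos (osc (D2 (D1 F)) a b (p - PI / 2) (q - PI / 2))) as P3.
  pose proof (Rabs_pos (IZR m)). pose proof (Rabs_pos (IZR n)).
  (* The four summands match the expansion of (1 + |a|) (1 + |b|) into 1, |a|, |b| and |a b|; the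
     edge integral is kept apart as [E]. *)
  apply (weight_le_coef_bound m n _
    (Rabs (osc F a b p q) + Rabs (osc (D1 F) a b (p - PI / 2) q)
     + Rabs (osc (D2 F) a b p (q - PI / 2))
     + Rabs (osc (D2 (D1 F)) a b (p - PI / 2) (q - PI / 2)))
    (Rabs (edge (D1 F) a b (p - PI / 2) (q - PI / 2)))).
  - unfold K; lra.
  - lra.
  - revert Ea Eb Eab P0 Hm Hn.
    generalize (Rabs (osc F a b p q)) (Rabs a) (Rabs b); intros J A B Ea Eb Eab P0 Hm Hn.
    assert ((1 + Rabs (IZR m)) * (1 + Rabs (IZR n)) <= (1 + A) * (1 + B))
      by (apply Rmult_le_compat; lra).
    apply Rle_trans with ((1 + A) * (1 + B) * J); [now apply Rmult_le_compat_r|].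
    replace ((1 + A) * (1 + B) * J) with (J + A * J + B * J + B * (A * J)) by ring.
    lra.
  - unfold K; nra.
  - unfold K; nra.
  - eapply Rle_trans; [apply B4|].
    apply Rle_trans with (K4 * (root_weight (m - n) ^ 2 + root_weight (m + n) ^ 2)).
    + apply Rmult_le_compat_l; lra.
    + apply Rmult_le_compat_r; [|unfold K; lra].
      apply Rplus_le_le_0_compat; apply pow2_ge_0.
Qed.

(** * Fourier coefficients *)

Lemma frac_part_id (x : R) : 0 <= x < 1 -> frac_part x = x.
Proof.
  intros Hx; destruct (Int_part_frac_part_spec x 0 x Hx) as [_ E]; [simpl; lra|now symmetry].
Qed.

Lemma is_RInt_zero {V : NormedModule R_AbsRing} (u v : R) :
  is_RInt (fun _ => zero : V) u v zero.
Proof.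
  apply (eq_ind _ (is_RInt (fun _ => zero : V) u v) (is_RInt_const u v (zero : V))).
  apply (scal_zero_r (V := NormedModule.ModuleSpace _ V)).
Qed.

Lemma is_RInt_lin4 (f1 f2 f3 f4 : R -> R) (c1 c2 c3 c4 l1 l2 l3 l4 u v : R) :
  is_RInt f1 u v l1 -> is_RInt f2 u v l2 -> is_RInt f3 u v l3 -> is_RInt f4 u v l4 ->
  is_RInt (fun x => c1 * f1 x + c2 * f2 x + c3 * f3 x + c4 * f4 x) u v
    (c1 * l1 + c2 * l2 + c3 * l3 + c4 * l4).
Proof.
  intros H1 H2 H3 H4.
  apply (is_RInt_plus (V := R_NormedModule));
    [apply (is_RInt_plus (V := R_NormedModule));
      [apply (is_RInt_plus (V := R_NormedModule))|]|];
    now apply (is_RInt_scal (V := R_NormedModule)).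
Qed.

Lemma is_RInt_inner (e : R) (f : R -> R -> R) (a p y : R) :
  0 < e -> smooth_on (collar e) f -> 0 <= y <= 1 ->
  is_RInt (fun x => f x y * cos (a * x + p)) (1 - y) 1 (inner f a p y).
Proof.
  intros He Hf Hy; apply (RInt_correct (V := R_CompleteNormedModule)).
  apply (ex_RInt_mult_cos (fun x => f x y)); [lra|]; intros x Hx.
  apply (smooth_continuous_slice e); trivial. now apply slice_triangle.
Qed.

Lemma is_RInt_osc (e : R) (f : R -> R -> R) (a b p q : R) :
  0 < e -> smooth_on (collar e) f ->
  is_RInt (fun y => inner f a p y * cos (b * y + q)) 0 1 (osc f a b p q).
Proof.
  intros He Hf; apply (RInt_correct (V := R_CompleteNormedModule)).
  apply ex_RInt_mult_cos; [lra|]. intros y Hy; now apply (continuous_inner e).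
Qed.

Lemma sin_cos_shift (t : R) : sin t = cos (t + - (PI / 2)).
Proof. rewrite <- cos_shift, <- cos_neg; f_equal; ring. Qed.

(** The addition formulas, with sines as cosines of phase - PI / 2 and the phase 0 written out, so
    that every term has the shape integrated in [inner] and [osc]. *)
Lemma Cmult_expi (z : C) (s t : R) :
  Cmult z (expi (- (s + t)))
  = (cos (t + 0) * (Re z * cos (s + 0))
       + - cos (t + - (PI / 2)) * (Re z * cos (s + - (PI / 2)))
       + cos (t + 0) * (Im z * cos (s + - (PI / 2)))
       + cos (t + - (PI / 2)) * (Im z * cos (s + 0)),
     cos (t + 0) * (Im z * cos (s + 0))
       + - cos (t + - (PI / 2)) * (Im z * cos (s + - (PI / 2)))
       + - cos (t + 0) * (Re z * cos (s + - (PI / 2)))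
       + - cos (t + - (PI / 2)) * (Re z * cos (s + 0))).
Proof.
  destruct z as [x y]; unfold expi, Cmult; simpl.
  rewrite cos_neg, sin_neg, cos_plus, sin_plus, <- !sin_cos_shift, !Rplus_0_r.
  f_equal; ring.
Qed.

Lemma fourier_coef_Psi (e : R) (F : R -> R -> C) (m n : Z) :
  let f x y := Re (F x y) in
  let g x y := Im (F x y) in
  let J h := osc h (2 * PI * IZR m) (2 * PI * IZR n) in
  let r := - (PI / 2) in
  0 < e -> smooth_on (collar e) f -> smooth_on (collar e) g ->
  fourier_coef (Psi F) m n
  = (1 * J f 0 0 + -1 * J f r r + 1 * J g r 0 + 1 * J g 0 r,
     1 * J g 0 0 + -1 * J g r r + -1 * J f r 0 + -1 * J f 0 r).
Proof.
  intros f g J r He Hf Hg.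
  set (a := 2 * PI * IZR m) in *; set (b := 2 * PI * IZR n) in *.
  unfold fourier_coef.
  rewrite (RInt_ext (V := C_R_CompleteNormedModule) _ (fun y =>
    (1 * (inner f a 0 y * cos (b * y + 0)) + -1 * (inner f a r y * cos (b * y + r))
       + 1 * (inner g a r y * cos (b * y + 0)) + 1 * (inner g a 0 y * cos (b * y + r)),
     1 * (inner g a 0 y * cos (b * y + 0)) + -1 * (inner g a r y * cos (b * y + r))
       + -1 * (inner f a r y * cos (b * y + 0)) + -1 * (inner f a 0 y * cos (b * y + r))))).
  - apply (is_RInt_unique (V := C_R_CompleteNormedModule)).
    apply (is_RInt_fct_extend_pair (U := R_NormedModule) (V := R_NormedModule));
      apply is_RInt_lin4; now apply (is_RInt_osc e).
  (* Only 0 < y < 1 has to be treated, where [y] equals its fractional part; the jump at 1 is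
     avoided, and likewise for [x] below. *)
  - rewrite Rmin_left, Rmax_right by lra; intros y Hy.
    set (c := cos (b * y + 0)); set (s := cos (b * y + r)).
    transitivity
      ((c * inner f a 0 y + - s * inner f a r y + c * inner g a r y + s * inner g a 0 y,
        c * inner g a 0 y + - s * inner g a r y + - c * inner f a r y + - s * inner f a 0 y)
       : C); [|apply injective_projections; simpl; ring].
    apply (is_RInt_unique (V := C_R_CompleteNormedModule)).
    (* The slice is cut at 1 - y: the left piece lies where [Psi F] is 0, the right piece where it
       is [F]. *)
    match goal with |- is_RInt _ _ _ ?z => rewrite <- (plus_zero_l z) end.
    apply (is_RInt_Chasles (V := C_R_NormedModule)) with (1 - y).
    + apply (is_RInt_ext (V := C_R_NormedModule) (fun _ => zero)).
      * rewrite Rmin_left, Rmax_right by lra; intros x Hx.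
        unfold Psi; rewrite !frac_part_id by lra.
        destruct Rlt_dec; [|lra]. symmetry; apply Cmult_0_l.
      * apply (is_RInt_zero (V := C_R_NormedModule)).
    + eapply (is_RInt_ext (V := C_R_NormedModule)).
      * rewrite Rmin_left, Rmax_right by lra; intros x Hx.
        unfold Psi; rewrite !frac_part_id by lra.
        destruct Rlt_dec; [lra|].
        replace (2 * PI * (IZR m * x + IZR n * y)) with (a * x + b * y)
          by (unfold a, b; ring).
        symmetry; apply Cmult_expi.
      * apply (is_RInt_fct_extend_pair (U := R_NormedModule) (V := R_NormedModule));
          apply is_RInt_lin4; apply (is_RInt_inner e); trivial; lra.
Qed.

Lemma Cmod_le_Rabs (x y : R) : Cmod (x, y) <= Rabs x + Rabs y.
Proof.
  pose proof (Rabs_pos x); pose proof (Rabs_pos y).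
  unfold Cmod; simpl fst; simpl snd.
  rewrite <- (sqrt_pow2 (Rabs x + Rabs y)) by lra.
  apply sqrt_le_1_alt; rewrite <- (pow2_abs x), <- (pow2_abs y); nra.
Qed.

Theorem theorem4 :
  forall F : R -> R -> C,
    Csmooth_near_triangle F ->
    (forall t : R, 0 <= t <= 1 ->
       F t (1 - t) = RtoC 0 /\ F 1 t = RtoC 0 /\ F t 1 = RtoC 0) ->
    abs_summable (fourier_coef (Psi F)).
Proof.
  intros F (U & HU & HT & Sf & Sg) H0.
  destruct (collar_in_open U HU HT) as (e & He & HeU).
  assert (Hf : smooth_on (collar e) (fun x y => Re (F x y)))
    by (intros n x y H; now apply Sf, HeU).
  assert (Hg : smooth_on (collar e) (fun x y => Im (F x y)))
    by (intros n x y H; now apply Sg, HeU).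
  destruct (osc_decay e _ He Hf) as [K HK].
  { intros t Ht; destruct (H0 t Ht) as (-> & -> & ->); now simpl. }
  destruct (osc_decay e _ He Hg) as [L HL].
  { intros t Ht; destruct (H0 t Ht) as (-> & -> & ->); now simpl. }
  (* The real and the imaginary part each consist of two integrals of [Re F] and two of [Im F], so
     each is at most 2 (K + L) times [coef_bound]. *)
  apply abs_summable_of_coef_bound with (4 * (K + L)); intros m n.
  rewrite (fourier_coef_Psi e) by trivial.
  eapply Rle_trans; [apply Cmod_le_Rabs|].
  set (r := - (PI / 2)).
  assert (A1 := HK m n 0 0); assert (A2 := HK m n r r);
    assert (A3 := HK m n r 0); assert (A4 := HK m n 0 r).
  assert (B1 := HL m n 0 0); assert (B2 := HL m n r r);
    assert (B3 := HL m n r 0); assert (B4 := HL m n 0 r).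
  apply Rabs_le_between in A1, A2, A3, A4, B1, B2, B3, B4.
  apply Rle_trans with ((2 * K * coef_bound m n + 2 * L * coef_bound m n)
                        + (2 * K * coef_bound m n + 2 * L * coef_bound m n)); [|lra].
  apply Rplus_le_compat; apply Rabs_le; lra.
Qed.
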